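(* (1) There is a polynomial reduction preserving approximation from IS on general (connected) graphs to SSGW restricted to DAGs with maximum in-degree $2$. (2) There is a polynomial reduction preserving approximation from ISDS on general (connected) graphs to Maximal SSGW restricted to DAGs with maximum in-degree $2$.
   Context: All (di)graphs are simple; a DAG is a digraph with no directed circuit. For a digraph $G=(V,A)$, $N^-_G(x)=\{u:(u,x)\in A\}$; $w(S)=\sum_{v\in S}w(v)$ for nonnegative weights $w$. A set $S$ satisfies the weak digraph constraints if for every $x\in V$, $N^-_G(x)\subseteq S$ and $N^-_G(x)\ne\emptyset$ imply $x\in S$. SSGW: given $G$, nonnegative weights $w$ and a bound $B>0$, find $S\subseteq V$ satisfying the weak digraph constraints and $w(S)\le B$, maximizing $w(S)$. Maximal SSGW: same input; find $S$ satisfying the weak digraph constraints and $w(S)\le B$ such that no $S'\supsetneq S$ satisfies both the weak digraph constraints and $w(S')\le B$, minimizing $w(S)$. IS: given a connected graph, find an independent set of maximum size. ISDS (minimum independent dominating set): given a connected graph $G=(V,E)$, find an independent set $V'$ such that every vertex of $V\setminus V'$ has a neighbor in $V'$, of minimum size. A reduction preserving approximation from problem $\Pi$ to problem $\Pi'$ consists of polynomial-time computable maps $f$, sending instances $I$ of $\Pi$ to instances $f(I)$ of $\Pi'$ (here within the stated restricted class), and $g$, sending each feasible solution $S'$ of $f(I)$ to a feasible solution $g(S')$ of $I$, such that the optimal values of $I$ and $f(I)$ coincide and the value of $g(S')$ in $I$ equals the value of $S'$ in $f(I)$ (so any approximation ratio achieved on $f(I)$ is achieved on $I$). *)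

(* Defs.v *)
From Corelib Require Import BinNums.
From mathcomp Require Import all_boot all_order all_algebra.

Set Implicit Arguments.
Unset Strict Implicit.
Unset Printing Implicit Defensive.

Import Order.TTheory GRing.Theory Num.Theory.

Definition word := seq bool.

(** * Polynomial time

    The machine model is the random access machine of Cook and Reckhow in
    structured form: a read-only input word, memory cells holding natural
    numbers with indirect addressing, and an append-only output word.  The only
    arithmetic is addition and truncated subtraction, and a program has finitely
    many expressions of fixed size; so after t steps every cell holds a number of
    O(t + log (size of the input)) bits, and unit cost is polynomially related to
    Turing machine time. *)

Inductive expr :=
  | Const of nat
  | InLen
  | In of expr
  | Mem of expr
  | Add of expr & expr
  | Sub of expr & expr.

Inductive cmd :=
  | Skip
  | Store of expr & expr
  | Write of expr
  | Seq of cmd & cmd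
  | If of expr & cmd & cmd
  | While of expr & cmd.

Definition memory := nat -> nat.

Record state := State { cells : memory; out : word }.

Definition init_state : state := State (fun=> 0%N) [::].

Fixpoint eval (w : word) (m : memory) (e : expr) : nat :=
  match e with
  | Const k => k
  | InLen => size w
  | In e1 => nth false w (eval w m e1)
  | Mem e1 => m (eval w m e1)
  | Add e1 e2 => (eval w m e1 + eval w m e2)%N
  | Sub e1 e2 => (eval w m e1 - eval w m e2)%N
  end.

Definition store (m : memory) (a k : nat) : memory :=
  fun b => if b == a then k else m b.

(** [exec w c s t s']: on input [w], the program [c] started in state [s] halts
    after exactly [t] steps in state [s'].  A condition holds if it is nonzero. *)
Inductive exec (w : word) : cmd -> state -> nat -> state -> Prop :=
  | exec_Skip s : exec w Skip s 1 s
  | exec_Store e1 e2 s :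
      exec w (Store e1 e2) s 1
        (State (store (cells s) (eval w (cells s) e1) (eval w (cells s) e2)) (out s))
  | exec_Write e s :
      exec w (Write e) s 1
        (State (cells s) (rcons (out s) (eval w (cells s) e != 0%N)))
  | exec_Seq c1 c2 s1 s2 s3 t1 t2 :
      exec w c1 s1 t1 s2 -> exec w c2 s2 t2 s3 ->
      exec w (Seq c1 c2) s1 (t1 + t2)%N s3
  | exec_If e c1 c2 s t s' :
      exec w (if eval w (cells s) e != 0%N then c1 else c2) s t s' ->
      exec w (If e c1 c2) s t.+1 s'
  | exec_WhileF e c s :
      eval w (cells s) e = 0%N -> exec w (While e c) s 1 s
  | exec_WhileT e c s1 s2 s3 t1 t2 :
      eval w (cells s1) e <> 0%N ->
      exec w c s1 t1 s2 -> exec w (While e c) s2 t2 s3 ->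
      exec w (While e c) s1 (t1 + t2).+1 s3.

(** A single program maps the word [inp x] to the word [outp x], in time
    polynomial in the length of [inp x], for every [x] in the domain [D]. *)
Definition polytime (X : Type) (D : X -> Prop) (inp outp : X -> word) : Prop :=
  exists (p : cmd) (c k : nat), forall x, D x ->
    exists (t : nat) (s : state),
      [/\ exec (inp x) p init_state t s,
          out s = outp x
        & (t <= c * size (inp x) ^ k + c)%N].

(** * Encodings *)

(** Self-delimiting, hence injective in [(u, v)]. *)
Definition enc_pair (u v : word) : word :=
  nseq (size u) true ++ false :: u ++ v.

(** Binary digits, least significant first. *)
Fixpoint pos_bits (p : positive) : word :=
  match p with
  | xH => [:: true]
  | xO p' => false :: pos_bits p'
  | xI p' => true :: pos_bits p'
  end.

Definition nat_bits (k : nat) : word :=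
  if bin_of_nat k is Npos p then pos_bits p else [::].

Definition enc_nat (k : nat) : word := enc_pair (nat_bits k) [::].

(** Only used for nonnegative [q], so that no sign is needed. *)
Definition enc_rat (q : rat) : word :=
  enc_nat `|numq q|%N ++ enc_nat `|denq q|%N.

(** The number of vertices in unary, followed by the adjacency matrix by rows. *)
Definition enc_rel (n : nat) (r : rel 'I_n) : word :=
  nseq n true ++ false :: [seq r x y | x <- enum 'I_n, y <- enum 'I_n].

Definition enc_set (n : nat) (S : {set 'I_n}) : word :=
  [seq x \in S | x <- enum 'I_n].

(** * Optimization problems and reductions preserving approximation *)

Record opt_problem := OptProblem {
  inst : Type;
  enc_inst : inst -> word;
  sol : inst -> Type;
  enc_sol : forall I : inst, sol I -> word;
  feasible : forall I : inst, sol I -> Prop;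
  value : forall I : inst, sol I -> rat;
  maximize : bool
}.

Arguments enc_inst : clear implicits.
Arguments sol : clear implicits.
Arguments enc_sol : clear implicits.
Arguments feasible : clear implicits.
Arguments value : clear implicits.

Definition is_opt (P : opt_problem) (I : inst P) (v : rat) : Prop :=
  (exists2 S : sol P I, feasible P I S & value P I S = v) /\
  (forall S : sol P I, feasible P I S ->
     if maximize P then (value P I S <= v)%R else (v <= value P I S)%R).

(** [C] is the class of instances of [Q] to which the target is restricted.  The
    map [g] sees both the instance of [P] and the solution of its image. *)
Definition approx_reduction (P Q : opt_problem) (C : inst Q -> Prop) : Prop :=
  exists (f : inst P -> inst Q) (g : forall I : inst P, sol Q (f I) -> sol P I),
  [/\ polytime (fun _ : inst P => True)
        (fun I => enc_inst P I) (fun I => enc_inst Q (f I)),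
      polytime (fun x : {I : inst P & sol Q (f I)} =>
                  feasible Q (f (projT1 x)) (projT2 x))
        (fun x => enc_pair (enc_inst P (projT1 x))
                           (enc_sol Q (f (projT1 x)) (projT2 x)))
        (fun x => enc_sol P (projT1 x) (g (projT1 x) (projT2 x))),
      forall I, C (f I),
      forall I, exists2 v, is_opt I v & is_opt (f I) v
    & forall I (S' : sol Q (f I)), feasible Q (f I) S' ->
        feasible P I (g I S') /\ value P I (g I S') = value Q (f I) S'].

Arguments approx_reduction : clear implicits.

(** * Independent sets *)

Record connected_graph := ConnectedGraph {
  gorder : nat;
  adj : rel 'I_gorder;
  adj_sym : symmetric adj;
  adj_irr : irreflexive adj;
  gorder_gt0 : (0 < gorder)%N;
  adj_connected : forall x y, connect adj x y
}.

Definition independent (G : connected_graph) (S : {set 'I_(gorder G)}) : Prop :=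
  forall x y, x \in S -> y \in S -> ~~ adj x y.

Definition dominating (G : connected_graph) (S : {set 'I_(gorder G)}) : Prop :=
  forall x, x \notin S -> exists2 y, y \in S & adj x y.

Definition IS : opt_problem := {|
  inst := connected_graph;
  enc_inst := fun G => enc_rel (@adj G);
  sol := fun G => {set 'I_(gorder G)};
  enc_sol := fun G S => enc_set S;
  feasible := fun G S => independent S;
  value := fun G S => (#|S|%:R)%R;
  maximize := true
|}.

Definition ISDS : opt_problem := {|
  inst := connected_graph;
  enc_inst := fun G => enc_rel (@adj G);
  sol := fun G => {set 'I_(gorder G)};
  enc_sol := fun G S => enc_set S;
  feasible := fun G S => independent S /\ dominating S;
  value := fun G S => (#|S|%:R)%R;
  maximize := false
|}.

(** * Subset sum with weak digraph constraints *)

Record ssg_inst := SsgInst {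
  dorder : nat;
  arc : rel 'I_dorder;
  arc_irr : irreflexive arc;
  weight : 'I_dorder -> rat;
  weight_ge0 : forall x, (0 <= weight x)%R;
  bound : rat;
  bound_gt0 : (0 < bound)%R
}.

Definition enc_ssg (I : ssg_inst) : word :=
  enc_rel (@arc I)
    ++ flatten [seq enc_rat (weight x) | x <- enum 'I_(dorder I)]
    ++ enc_rat (bound I).

Definition in_nbrs (I : ssg_inst) (x : 'I_(dorder I)) : {set 'I_(dorder I)} :=
  [set u | arc u x].

Definition total_weight (I : ssg_inst) (S : {set 'I_(dorder I)}) : rat :=
  (\sum_(x in S) weight x)%R.

Definition weak_constraints (I : ssg_inst) (S : {set 'I_(dorder I)}) : Prop :=
  forall x, in_nbrs x \subset S -> in_nbrs x != set0 -> x \in S.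

Definition ssgw_feasible (I : ssg_inst) (S : {set 'I_(dorder I)}) : Prop :=
  weak_constraints S /\ (total_weight S <= bound I)%R.

Definition SSGW : opt_problem := {|
  inst := ssg_inst;
  enc_inst := enc_ssg;
  sol := fun I => {set 'I_(dorder I)};
  enc_sol := fun I S => enc_set S;
  feasible := fun I S => ssgw_feasible S;
  value := fun I S => total_weight S;
  maximize := true
|}.

Definition MaximalSSGW : opt_problem := {|
  inst := ssg_inst;
  enc_inst := enc_ssg;
  sol := fun I => {set 'I_(dorder I)};
  enc_sol := fun I S => enc_set S;
  feasible := fun I S =>
    ssgw_feasible S /\ (forall S' : {set 'I_(dorder I)}, S \proper S' -> ~ ssgw_feasible S');
  value := fun I S => total_weight S;
  maximize := false
|}.

(** [cycle] from the library also accepts the empty sequence. *)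
Definition is_dag (I : ssg_inst) : Prop :=
  forall c : seq 'I_(dorder I), c <> [::] -> ~~ cycle (@arc I) c.

(** As usual for degree-restricted classes, "maximum in-degree 2" bounds the
    in-degree by 2; it need not be attained. *)
Definition dag_indeg2 (I : ssg_inst) : Prop :=
  is_dag I /\ (forall x : 'I_(dorder I), (#|in_nbrs x| <= 2)%N).

(* Main.v *)
Require Import Defs.
From mathcomp Require Import all_boot all_order all_algebra zify.

(** For a graph on [n] vertices, add to the vertices, of weight 1, one gadget for
    each ordered pair [(x, y)], of weight [2 ^ n.+1] and with in-neighbours [x] and
    [y] if [x] and [y] are adjacent, none otherwise.  With the bound [2 ^ n], no
    feasible set contains a gadget, so that the feasible sets are exactly the
    independent sets of the graph, their weight is their size, and the maximal ones
    are the independent dominating sets.  All arcs go from vertices to gadgets, hence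
    the digraph is acyclic.  Indexing the gadgets by all pairs lets the input matrix
    be scanned in order, and powers of two have binary expansions that can be
    written without any arithmetic. *)

Set Implicit Arguments.
Unset Strict Implicit.
Unset Printing Implicit Defensive.

Import Order.TTheory GRing.Theory Num.Theory Defs.

(** * Polynomial bounds *)

Definition poly_bounded (T : nat -> nat) : Prop :=
  exists c k, forall n, T n <= c * n ^ k + c.

Lemma poly_bounded_const a : poly_bounded (fun=> a).
Proof. by exists a, 0 => n; lia. Qed.

Lemma poly_bounded_id : poly_bounded id.
Proof. by exists 1, 1 => n; rewrite expn1; lia. Qed.

(** The extra 1 covers [n = 0], where [0 ^ 0 = 1] exceeds [0 ^ l]. *)
Lemma leq_exp_succ k l n : k <= l -> n ^ k <= n ^ l + 1.
Proof.
case: n => [|n] le_kl; last by rewrite (leq_trans (leq_pexp2l _ le_kl)) ?leq_addr.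
by case: k le_kl => [|k] _; [rewrite expn0 leq_addl | rewrite exp0n].
Qed.

Lemma poly_bounded_add S T :
  poly_bounded S -> poly_bounded T -> poly_bounded (fun n => S n + T n).
Proof.
(* Raising both exponents to [k + l] costs an additive [c + d], absorbed by the factor 2. *)
move=> [c [k hS]] [d [l hT]]; exists ((c + d) * 2), (k + l) => n.
have le_l := leq_exp_succ n (leq_addl k l).
have le_k := leq_exp_succ n (leq_addr l k).
apply: leq_trans (leq_add (hS n) (hT n)) _.
move: (n ^ k) (n ^ l) (n ^ (k + l)) le_k le_l => a b p le_k le_l.
by have := leq_mul (leqnn c) le_k; have := leq_mul (leqnn d) le_l; lia.
Qed.

Lemma poly_bounded_mul S T :
  poly_bounded S -> poly_bounded T -> poly_bounded (fun n => S n * T n).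
Proof.
move=> [c [k hS]] [d [l hT]]; exists (c * d * 4), (k + l) => n.
apply: leq_trans (leq_mul (hS n) (hT n)) _.
have := leq_exp_succ n (leq_addr l k); have := leq_exp_succ n (leq_addl k l).
rewrite expnD; move: (n ^ k) (n ^ l) => a b le_b le_a.
(* Both [a] and [b] are at most [a * b + 1], so the last factor is at most [4 * (a * b) + 4]. *)
have -> : (c * a + c) * (d * b + d) = (c * d) * (a * b + a + b + 1) by lia.
have -> : c * d * 4 * (a * b) + c * d * 4 = (c * d) * (4 * (a * b) + 4) by lia.
by apply: leq_mul => //; lia.
Qed.

Lemma leq_poly_bound_arg c k m n : m <= n -> c * m ^ k + c <= c * n ^ k + c.
Proof.
case: k => [|k] le_mn; first by rewrite !expn0.
by rewrite leq_add2r leq_mul2l leq_exp2r // le_mn orbT.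
Qed.

(** * Hoare triples for random access machines *)

Section Hoare.

Variable w : word.

(** [o] is the word appended to the output, and [T] bounds the running time. *)
Definition runs (P : memory -> Prop) (c : cmd) (T : nat) (o : word)
    (Q : memory -> Prop) : Prop :=
  forall m u, P m -> exists t m',
    [/\ exec w c (State m u) t (State m' (u ++ o)), t <= T & Q m'].

Lemma runs_conseq (P' Q' : memory -> Prop) P c T o Q :
    runs P' c T o Q' -> (forall m, P m -> P' m) -> (forall m, Q' m -> Q m) ->
  runs P c T o Q.
Proof.
move=> run_c PP' QQ' m u /PP'/run_c-/(_ u)[t [m' [ex_c le_t /QQ' Qm']]].
by exists t, m'.
Qed.

Lemma runs_skip P : runs P Skip 1 [::] P.
Proof. by move=> m u Pm; exists 1, m; rewrite cats0; split=> //; constructor. Qed.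

Lemma runs_store (P Q : memory -> Prop) e1 e2 :
    (forall m, P m -> Q (store m (eval w m e1) (eval w m e2))) ->
  runs P (Store e1 e2) 1 [::] Q.
Proof.
move=> PQ m u Pm; exists 1, (store m (eval w m e1) (eval w m e2)).
by rewrite cats0; split=> //; [apply: (exec_Store w e1 e2 (State m u)) | apply: PQ].
Qed.

Lemma runs_write (P : memory -> Prop) e b :
  (forall m, P m -> (eval w m e != 0) = b) -> runs P (Write e) 1 [:: b] P.
Proof.
move=> Pe m u Pm; exists 1, m; split=> //.
by rewrite cats1 -(Pe m Pm); apply: (exec_Write w e (State m u)).
Qed.

Lemma runs_seq R P c1 c2 T1 T2 o1 o2 Q :
    runs P c1 T1 o1 R -> runs R c2 T2 o2 Q ->
  runs P (Seq c1 c2) (T1 + T2) (o1 ++ o2) Q.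
Proof.
move=> run1 run2 m u /run1-/(_ u)[t1 [m1 [ex1 le1 /run2-/(_ (u ++ o1))]]].
move=> [t2 [m2 [ex2 le2 Qm2]]]; exists (t1 + t2), m2.
by rewrite catA; split=> //; [apply: exec_Seq ex1 ex2 | apply: leq_add].
Qed.

(** [Inv k] describes the memory after [k] passes. Each pass pays one step for its test, and the
    final 1 is the failing test. *)
Lemma runs_while (Inv : nat -> memory -> Prop) e c T (o : nat -> word) n :
    (forall k, k < n -> runs (Inv k) c T (o k) (Inv k.+1)) ->
    (forall k m, k < n -> Inv k m -> eval w m e <> 0) ->
    (forall m, Inv n m -> eval w m e = 0) ->
  runs (Inv 0) (While e c) (n * T.+1 + 1) (flatten [seq o k | k <- iota 0 n]) (Inv n).
Proof.
move=> run_c e_true e_false.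
(* Induction on the number [d] of remaining passes. *)
suff H d k : k + d = n -> runs (Inv k) (While e c) (d * T.+1 + 1)
    (flatten [seq o j | j <- iota k d]) (Inv n) by apply: H.
elim: d k => [|d IHd] k def_n m u Im.
  rewrite addn0 in def_n; subst k.
  by exists 1, m; rewrite cats0; split=> //; apply: exec_WhileF; apply: e_false.
have lt_kn : k < n by lia.
have [t1 [m1 [ex1 le1 Im1]]] := run_c k lt_kn m u Im.
have [|t2 [m2 [ex2 le2 Im2]]] := IHd k.+1 _ m1 (u ++ o k) Im1; first by lia.
exists (t1 + t2).+1, m2; split=> //; last by rewrite mulSn; lia.
rewrite /= catA; apply: exec_WhileT ex1 ex2.
exact: e_true lt_kn Im.
Qed.

End Hoare.

Definition reg (i : nat) : expr := Mem (Const i).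

(** Truncated subtraction serves as the test [i < e]; the bound [e] is evaluated anew before every
    pass. *)
Definition for_loop (i : nat) (e : expr) (c : cmd) : cmd :=
  Seq (Store (Const i) (Const 0))
      (While (Sub e (reg i)) (Seq c (Store (Const i) (Add (reg i) (Const 1))))).

Definition write_word (o : word) : cmd :=
  foldr (fun b : bool => Seq (Write (Const b))) Skip o.

Section Loops.

Variable w : word.

(** The first hypothesis makes [Inv] independent of the counter cell, so initialization and
    increments preserve it. A pass costs [T], an increment and a test. *)
Lemma runs_for (Inv : nat -> memory -> Prop) i e c T (o : nat -> word) n :
    (forall k m v, Inv k m -> Inv k (store m i v)) ->
    (forall k m, Inv k m -> eval w m e = n) ->
    (forall k, k < n -> runs w (fun m => m i = k /\ Inv k m) c T (o k)
                               (fun m => m i = k /\ Inv k.+1 m)) ->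
  runs w (Inv 0) (for_loop i e c) (n * (T + 2) + 2)
    (flatten [seq o k | k <- iota 0 n]) (Inv n).
Proof.
move=> InvS eE run_c.
pose J k m := m i = k /\ Inv k m.
rewrite -[flatten _]cat0s.
have -> : n * (T + 2) + 2 = 1 + (n * (T + 1).+1 + 1) by lia.
apply: (@runs_conseq _ (Inv 0) (J n)) => // [|m []//].
apply: (runs_seq (R := J 0)).
  by apply: runs_store => m Im /=; split; [rewrite /store eqxx | apply: InvS].
apply: runs_while => [k lt_kn|k m lt_kn|m] /=.
- rewrite -[o k]cats0; apply: runs_seq (run_c k lt_kn) _.
  apply: runs_store => m [mi Im] /=.
  by split; [rewrite /store eqxx mi addn1 | apply: InvS].
- by move=> [mi /eE->]; rewrite mi; lia.
- by move=> [mi /eE->]; rewrite mi subnn.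
Qed.

Lemma runs_for_const (P : memory -> Prop) i e c T (o : nat -> word) n :
    (forall m v, P m -> P (store m i v)) ->
    (forall m, P m -> eval w m e = n) ->
    (forall k, k < n -> runs w (fun m => m i = k /\ P m) c T (o k)
                               (fun m => m i = k /\ P m)) ->
  runs w P (for_loop i e c) (n * (T + 2) + 2) (flatten [seq o k | k <- iota 0 n]) P.
Proof. by move=> PS eE run_c; apply: (runs_for (Inv := fun=> P)). Qed.

Lemma runs_write_word P o : runs w P (write_word o) (size o).+1 o P.
Proof.
elim: o => [|b o IHo]; first exact: runs_skip.
apply: (runs_seq (T1 := 1) (o1 := [:: b])) IHo.
by apply: runs_write => m _ /=; case: b.
Qed.

End Loops.

(** * The program building the digraph *)

Ltac solve_regs := intros; unfold store in *; simpl in *; lia.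

Lemma flatten_const1 (T I : Type) (x : T) (s : seq I) :
  flatten [seq [:: x] | _ <- s] = nseq (size s) x.
Proof. by elim: s => //= i s ->. Qed.

Lemma flatten_const0 (T I : Type) (s : seq I) :
  flatten [seq [::] | _ <- s] = [::] :> seq T.
Proof. by elim: s. Qed.

Definition incr (i : nat) (e : expr) : cmd := Store (Const i) (Add (reg i) e).

Definition count_ones (i : nat) (e : expr) : cmd :=
  While (In (Add e (reg i))) (incr i (Const 1)).

Definition pow2_prog (e : expr) : cmd :=
  Seq (for_loop 6 e (write_word [:: true]))
  (Seq (write_word [:: true; false])
  (Seq (for_loop 6 e (write_word [:: false])) (write_word [:: true]))).

(** This is [enc_nat (2 ^ k)]: the length [k.+1] in unary with its separator, then [k] zero bits and
    the leading one. *)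
Definition pow2_word (k : nat) : word :=
  nseq k true ++ [:: true; false] ++ nseq k false ++ [:: true].

Definition pow2_time (k : nat) : nat := (k * 4 + 2) + (3 + ((k * 4 + 2) + 2)).

(** Cell 0 holds [n], cell 1 holds [n + n * n]; cells 2, 3, 4 and 6 are loop
    counters, and cell 5 points to the entry [(x, y)] of the input matrix. *)
Definition order_prog : cmd :=
  Seq (count_ones 0 (Const 0))
  (Seq (Store (Const 1) (reg 0)) (for_loop 6 (reg 0) (incr 1 (reg 0)))).

Definition not_expr (e : expr) : expr := Sub (Const 1) e.

Definition eq_expr (e1 e2 : expr) : expr :=
  not_expr (Add (Sub e1 e2) (Sub e2 e1)).

(** Conjunction by De Morgan, with [Add] as disjunction: the entry is set and the source in cell 2
    is one of the pair in cells 3 and 4. *)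
Definition arc_expr : expr :=
  not_expr (Add (not_expr (In (reg 5)))
                (not_expr (Add (eq_expr (reg 2) (reg 3)) (eq_expr (reg 2) (reg 4))))).

(** The first [n] columns are vertices, which have no in-neighbours. The gadgets follow in the order
    of the input matrix, so incrementing cell 5 replaces computing a position by multiplication. *)
Definition row_prog : cmd :=
  Seq (for_loop 6 (reg 0) (write_word [:: false]))
  (Seq (Store (Const 5) (Add (reg 0) (Const 1)))
  (for_loop 3 (reg 0) (for_loop 4 (reg 0)
    (Seq (Write arc_expr) (incr 5 (Const 1)))))).

Definition matrix_prog : cmd :=
  Seq (for_loop 6 (reg 1) (write_word [:: true]))
  (Seq (write_word [:: false]) (for_loop 2 (reg 1) row_prog)).

(** This is [enc_nat 1], also the denominator of every rational written. *)
Definition one_word : word := [:: true; false; true].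

Definition weight_prog : cmd :=
  Seq (for_loop 3 (reg 0) (write_word (one_word ++ one_word)))
  (Seq (for_loop 3 (reg 0) (for_loop 4 (reg 0)
         (Seq (pow2_prog (Add (reg 0) (Const 1))) (write_word one_word))))
       (Seq (pow2_prog (reg 0)) (write_word one_word))).

Definition ssg_prog : cmd := Seq order_prog (Seq matrix_prog weight_prog).

Definition row_word (w : word) (n u : nat) : word :=
  nseq n false ++
  flatten [seq flatten [seq [:: nth false w (n + (x * n + y)).+1
                                && ((u == x) || (u == y))] | y <- iota 0 n]
              | x <- iota 0 n].

Definition matrix_word (w : word) (n : nat) : word :=
  nseq (n + n * n) true ++
  [:: false] ++ flatten [seq row_word w n u | u <- iota 0 (n + n * n)].

(** The three blocks are the vertex weights, the gadget weights and the bound. *)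
Definition weight_word (n : nat) : word :=
  flatten [seq one_word ++ one_word | _ <- iota 0 n] ++
  flatten [seq flatten [seq pow2_word n.+1 ++ one_word | _ <- iota 0 n]
              | _ <- iota 0 n] ++
  (pow2_word n ++ one_word).

Definition order_time (n : nat) : nat := (n * 2 + 1) + (1 + (n * 3 + 2)).

Definition row_time (n : nat) : nat :=
  (n * 4 + 2) + (1 + (n * (n * 4 + 2 + 2) + 2)).

Definition matrix_time (n : nat) : nat :=
  ((n + n * n) * 4 + 2) + (2 + ((n + n * n) * (row_time n + 2) + 2)).

Definition weight_time (n : nat) : nat :=
  (n * 9 + 2) +
  ((n * (n * (pow2_time (n + 1) + 4 + 2) + 2 + 2) + 2) + (pow2_time n + 4)).

Definition ssg_time (n : nat) : nat :=
  order_time n + (matrix_time n + weight_time n).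

Lemma poly_bounded_ssg_time : poly_bounded ssg_time.
Proof.
rewrite /ssg_time /order_time /matrix_time /weight_time /row_time /pow2_time.
repeat first [ apply: poly_bounded_const | apply: poly_bounded_id
             | apply: poly_bounded_add | apply: poly_bounded_mul ].
Qed.

Lemma runs_count_ones w (P : memory -> Prop) i e a n :
    (forall m v, P m -> P (store m i v)) ->
    (forall m, P m -> eval w m e = a) ->
    (forall k, k <= n -> nth false w (a + k) = (k < n)) ->
  runs w (fun m => m i = 0 /\ P m) (count_ones i e) (n * 2 + 1) [::]
         (fun m => m i = n /\ P m).
Proof.
move=> PS eE w_ones.
pose J k m := m i = k /\ P m.
(* The empty output is presented as the concatenation of [n] empty words, as [runs_while]
   expects. *)
rewrite -(@flatten_const0 bool _ (iota 0 n)).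
apply: (runs_while (Inv := J)) => [k lt_kn|k m lt_kn|m] /=.
- apply: runs_store => m [mi Pm] /=.
  by split; [rewrite /store eqxx mi addn1 | apply: PS].
- by case=> mi Pm; rewrite eE // mi w_ones ?lt_kn // ltnW.
- by case=> mi Pm; rewrite eE // mi w_ones ?ltnn.
Qed.

Section SsgProg.

Variables (w : word) (n : nat).

Hypothesis w_ones : forall k, k <= n -> nth false w k = (k < n).

Let P m := m 0 = n /\ m 1 = n + n * n.

Lemma runs_pow2 (Q : memory -> Prop) e k :
    (forall m v, Q m -> Q (store m 6 v)) -> (forall m, Q m -> eval w m e = k) ->
  runs w Q (pow2_prog e) (pow2_time k) (pow2_word k) Q.
Proof.
move=> QS eE; rewrite /pow2_word.
have loop b : runs w Q (for_loop 6 e (write_word [:: b])) (k * 4 + 2) (nseq k b) Q.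
  rewrite -{2}(size_iota 0 k) -flatten_const1.
  by apply: (runs_for_const (T := 2)) => // j lt_jk; apply: runs_write_word.
apply: runs_seq (loop _) _; apply: runs_seq; first exact: runs_write_word.
by apply: runs_seq (loop _) _; apply: runs_write_word.
Qed.

Lemma runs_order : runs w (fun m => m 0 = 0) order_prog (order_time n) [::] P.
Proof.
(* The square is obtained by repeated addition. *)
pose Inv k m := m 0 = n /\ m 1 = n + k * n.
rewrite -[[::]]/([::] ++ [::] ++ [::]) -{3}(@flatten_const0 bool _ (iota 0 n)).
apply: (@runs_conseq _ (fun m => m 0 = 0 /\ True) P) => //.
apply: runs_seq; first exact: (runs_count_ones (a := 0)).
apply: (runs_seq (R := Inv 0)).
  by apply: runs_store; rewrite /Inv; solve_regs.
apply: (runs_for (Inv := Inv) (T := 1)); rewrite /Inv; [solve_regs.. |].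
move=> k lt_kn; apply: runs_store; solve_regs.
Qed.

Lemma runs_row u :
  runs w (fun m => m 2 = u /\ P m) row_prog (row_time n) (row_word w n u)
         (fun m => m 2 = u /\ P m).
Proof.
rewrite /row_prog /row_word.
apply: runs_seq.
  rewrite -{2}(size_iota 0 n) -flatten_const1.
  apply: (runs_for_const (T := 2)); rewrite /P; [solve_regs.. |].
  by move=> k lt_kn; apply: runs_write_word.
pose Inv x m := m 5 = (n + (x * n)).+1 /\ (m 2 = u /\ P m).
rewrite -[flatten _]cat0s.
apply: (runs_seq (R := Inv 0)).
  by apply: runs_store; rewrite /Inv /P; solve_regs.
apply: (@runs_conseq _ (Inv 0) (Inv n)) => //; last by move=> m [].
apply: (runs_for (Inv := Inv) (T := n * 4 + 2)); rewrite /Inv /P; [solve_regs.. |].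
move=> x lt_xn.
pose Inv2 y m := m 5 = (n + (x * n + y)).+1 /\ (m 3 = x /\ m 2 = u /\ P m).
(* Moving past the last entry of row [x] reaches the first entry of row [x.+1], so [Inv2 n] gives
   the outer invariant at [x.+1]. *)
apply: (@runs_conseq _ (Inv2 0) (Inv2 n)) => //; rewrite /Inv2 /P; [|solve_regs..].
apply: (runs_for (Inv := Inv2) (T := 2)); rewrite /Inv2 /P; [solve_regs.. |].
move=> y lt_yn; rewrite -[X in runs _ _ _ _ X _]cats0.
apply: (runs_seq (T1 := 1) (T2 := 1)); last first.
  apply: (runs_store (P := fun m => m 4 = y /\ Inv2 y m)).
  by rewrite /Inv2 /P; solve_regs.
apply: runs_write => m [m4 [m5 [m3 [m2 _]]]] /=.
by rewrite m2 m3 m4 m5; case: (nth _ _ _) => /=; lia.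
Qed.

Lemma runs_matrix : runs w P matrix_prog (matrix_time n) (matrix_word w n) P.
Proof.
apply: runs_seq.
  rewrite -{2}(size_iota 0 (n + n * n)) -flatten_const1.
  apply: (runs_for_const (T := 2)); rewrite /P; [solve_regs.. |].
  by move=> k lt_kn; apply: runs_write_word.
apply: runs_seq; first exact: runs_write_word.
apply: (runs_for_const (T := row_time n)); rewrite /P; [solve_regs.. |].
by move=> u _; apply: runs_row.
Qed.

Lemma runs_weight : runs w P weight_prog (weight_time n) (weight_word n) P.
Proof.
apply: runs_seq.
  apply: (runs_for_const (T := 7)); rewrite /P; [solve_regs.. |].
  by move=> k lt_kn; apply: runs_write_word.
apply: (runs_seq (R := P)); last first.
  apply: runs_seq; last exact: runs_write_word.
  by apply: runs_pow2; rewrite /P; solve_regs.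
apply: (runs_for_const (T := n * (pow2_time (n + 1) + 4 + 2) + 2)); rewrite /P.
- by solve_regs.
- by solve_regs.
move=> x _.
apply: (runs_for_const (T := pow2_time (n + 1) + 4)); [solve_regs.. |].
move=> y _; rewrite -[n.+1]addn1.
apply: runs_seq; last exact: runs_write_word.
by apply: runs_pow2; solve_regs.
Qed.

Lemma runs_ssg :
  runs w (fun m => m 0 = 0) ssg_prog (ssg_time n) (matrix_word w n ++ weight_word n) P.
Proof.
rewrite -[matrix_word w n]cat0s -catA.
by apply: runs_seq runs_order _; apply: runs_seq runs_matrix runs_weight.
Qed.

End SsgProg.

(** * The program restricting a solution to the vertices *)

(** On an input [enc_pair (enc_rel r) s], cell 0 receives the length of [enc_rel r]
    and cell 1 the number of vertices. *)
Definition restrict_prog : cmd :=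
  Seq (count_ones 0 (Const 0))
  (Seq (count_ones 1 (Add (reg 0) (Const 1)))
       (for_loop 2 (reg 1)
          (Write (In (Add (Add (reg 0) (Const 1)) (Add (reg 0) (reg 2))))))).

Lemma nth_enc_pair u v i :
  nth false (enc_pair u v) (size u + 1 + i) = nth false (u ++ v) i.
Proof. by rewrite [LHS]nth_cat size_nseq ltnNge -addnA leq_addr /= addKn add1n. Qed.

Lemma nth_enc_pair_ones u v k :
  k <= size u -> nth false (enc_pair u v) k = (k < size u).
Proof.
by rewrite nth_cat size_nseq nth_nseq leq_eqVlt => /orP[/eqP->|->//]; rewrite ltnn subnn.
Qed.

Lemma nth_enc_rel_ones n (r : rel 'I_n) k :
  k <= n -> nth false (enc_rel r) k = (k < n).
Proof.
by rewrite nth_cat size_nseq nth_nseq leq_eqVlt => /orP[/eqP->|->//]; rewrite ltnn subnn.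
Qed.

Lemma size_enc_rel n (r : rel 'I_n) : size (enc_rel r) = n + (n * n).+1.
Proof. by rewrite size_cat size_nseq /= size_allpairs size_enum_ord. Qed.

Lemma nth_flatten_rows (T : Type) (x0 : T) (ss : seq (seq T)) n i j :
    all (fun s => size s == n) ss -> j < n ->
  nth x0 (flatten ss) (i * n + j) = nth x0 (nth [::] ss i) j.
Proof.
elim: ss i => [|s ss IHss] [|i] /=; rewrite ?nth_nil //.
  by case/andP=> /eqP sz_s _ lt_jn; rewrite nth_cat sz_s lt_jn.
case/andP=> /eqP sz_s sz_ss lt_jn; rewrite nth_cat sz_s ltnNge mulSn -addnA leq_addr /=.
by rewrite addKn IHss.
Qed.

Lemma nth_enc_rel n (r : rel 'I_n) (x y : 'I_n) :
  nth false (enc_rel r) (n + (x * n + y)).+1 = r x y.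
Proof.
rewrite nth_cat size_nseq ltnNge -addnS leq_addr /= addKn /=.
rewrite nth_flatten_rows //; last first.
  by apply/allP=> _ /mapP[z _ ->]; rewrite size_map size_enum_ord.
by rewrite (nth_map x) ?size_enum_ord // (nth_map y) ?size_enum_ord // !nth_ord_enum.
Qed.

Lemma runs_restrict n (r : rel 'I_n) (s : word) :
  let L := size (enc_rel r) in
  runs (enc_pair (enc_rel r) s) (fun m => m 0 = 0 /\ m 1 = 0) restrict_prog
    ((L * 2 + 1) + ((n * 2 + 1) + (n * 3 + 2)))
    [seq nth false s i | i <- iota 0 n] (fun=> True).
Proof.
move=> L; set w := enc_pair _ _.
pose P m := m 1 = n /\ m 0 = L.
rewrite -[map _ _]cat0s; apply: (runs_seq (R := fun m => m 1 = 0 /\ m 0 = L)).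
  apply: (@runs_conseq _ (fun m => m 0 = 0 /\ m 1 = 0) (fun m => m 0 = L /\ m 1 = 0)).
  - apply: (runs_count_ones (a := 0)) => // k le_kL.
    by rewrite add0n nth_enc_pair_ones.
  - by [].
  - by move=> m [].
rewrite -[map _ _]cat0s; apply: (runs_seq (R := P)).
  (* [enc_rel r] starts after the [L] ones and the separator, and itself begins with [n] in
     unary. *)
  apply: (runs_count_ones (a := L + 1)); [solve_regs.. |] => k le_kn.
  rewrite nth_enc_pair nth_cat size_enc_rel ifT ?nth_enc_rel_ones //.
  by rewrite (leq_ltn_trans le_kn) // addnS ltnS leq_addr.
rewrite -flatten_map1; apply: (@runs_conseq _ P P) => //.
apply: (runs_for_const (T := 1)); rewrite /P; [solve_regs.. |] => i lt_in.
apply: runs_write => m [m2 [m1 m0]] /=.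
(* The address [(L + 1) + (L + i)] lies past [enc_rel r] and holds bit [i] of [s]. *)
rewrite m0 m2 nth_enc_pair nth_cat ltnNge leq_addr /= addKn.
by case: nth.
Qed.

(** Row-major order matches the list of gadgets with the nested loops of the program. *)
Lemma iota_mul m a b :
  iota m (a * b) =
  flatten [seq [seq m + (x * b + y) | y <- iota 0 b] | x <- iota 0 a].
Proof.
elim: a => [|a IHa]; first by rewrite mul0n.
rewrite mulSnr iotaD IHa -(addn1 a) iotaD map_cat flatten_cat /= cats0.
by congr (_ ++ _); rewrite -[m + a * b]addn0 iotaDl; apply: eq_map => y; rewrite addnA.
Qed.

(** * Encodings of powers of two *)

Lemma nat_bits_pow2 k : nat_bits (2 ^ k) = nseq k false ++ [:: true].
Proof.
have -> : 2 ^ k = BinNums.Npos (iter k BinNums.xO BinNums.xH).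
  elim: k => //= k IHk.
  by rewrite NatTrec.doubleE expnS IHk mul2n.
rewrite /nat_bits nat_of_binK.
by elim: k => //= k ->.
Qed.

Lemma enc_nat_pow2 k : enc_nat (2 ^ k) = pow2_word k.
Proof.
rewrite /enc_nat nat_bits_pow2 /enc_pair cats0 size_cat size_nseq /=.
by rewrite nseqD -catA.
Qed.

Lemma enc_rat_pow2 k : enc_rat (2 ^ k)%:R%R = pow2_word k ++ one_word.
Proof. by rewrite /enc_rat -[_%:R%R]/(2 ^ k)%:Z%:~R%R numq_int denq_int enc_nat_pow2. Qed.

(** * The digraph *)

(** Vertex [n + (x * n + y)] is the gadget of the pair [(x, y)]; the entry [(x, y)]
    of the matrix is at position [(n + (x * n + y)).+1] of the encoding [w]. *)
Definition pair_arc (w : word) (n u v : nat) : bool :=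
  [&& n <= v, nth false w v.+1 & (u == (v - n) %/ n) || (u == (v - n) %% n)].

(** The quotient and the remainder of [v - n] by [n] are both below [n]. Irreflexivity and
    acyclicity follow from this. *)
Lemma pair_arc_bounds w n u v : v < n + n * n -> pair_arc w n u v -> u < n <= v.
Proof.
move=> lt_v /and3P[le_nv _ eq_u].
have n_gt0 : 0 < n by case: n lt_v {le_nv eq_u} => //; rewrite muln0.
rewrite le_nv andbT.
by case/orP: eq_u => /eqP->; rewrite ?ltn_mod // ltn_divLR //; lia.
Qed.

Section Digraph.

Variable G : connected_graph.

Let n := gorder G.

Definition pair_rel : rel 'I_(n + n * n) :=
  fun u v => pair_arc (enc_rel (@adj G)) n u v.

Definition pair_weight (v : 'I_(n + n * n)) : rat :=
  (if (v < n)%N then 1 else (2 ^ n.+1)%:R)%R.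

Lemma pair_rel_irr : irreflexive pair_rel.
Proof.
by move=> u; apply/negP=> /(pair_arc_bounds (ltn_ord u))/andP[lt_un]; rewrite leqNgt lt_un.
Qed.

Lemma pair_weight_ge0 v : (0 <= pair_weight v)%R.
Proof. by rewrite /pair_weight; case: ifP => _; rewrite ?ler01 ?ler0n. Qed.

Lemma pow2_bound_gt0 : (0 < (2 ^ n)%:R :> rat)%R.
Proof. by rewrite ltr0n expn_gt0. Qed.

Definition pair_digraph : ssg_inst :=
  SsgInst pair_rel_irr pair_weight_ge0 pow2_bound_gt0.

Definition vertex_of (x : 'I_n) : 'I_(dorder pair_digraph) := lshift (n * n) x.

Definition restrict (S : {set 'I_(dorder pair_digraph)}) : {set 'I_n} :=
  [set x | vertex_of x \in S].

Definition extend (S : {set 'I_n}) : {set 'I_(dorder pair_digraph)} :=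
  vertex_of @: S.

Lemma vertex_of_inj : injective vertex_of.
Proof. exact: lshift_inj. Qed.

Lemma extendK : cancel extend restrict.
Proof. by move=> S; apply/setP=> x; rewrite inE mem_imset //; apply: vertex_of_inj. Qed.

Lemma pair_vertex_lt (x y : 'I_n) : n + (x * n + y) < n + n * n.
Proof.
rewrite ltn_add2l; apply: (@leq_trans (x.+1 * n)); last by rewrite leq_mul2r ltn_ord orbT.
by rewrite mulSn addnC ltn_add2r.
Qed.

Definition pair_vertex (x y : 'I_n) : 'I_(dorder pair_digraph) :=
  Ordinal (pair_vertex_lt x y).

Lemma in_nbrs_pair x y :
  in_nbrs (pair_vertex x y) =
  if adj x y then [set vertex_of x; vertex_of y] else set0.
Proof.
have n_gt0 : 0 < n := gorder_gt0 G.
apply/setP=> u; rewrite inE /= /pair_rel /pair_arc /= leq_addr nth_enc_rel addKn.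
rewrite divnMDl // divn_small ?ltn_ord // addn0 modnMDl modn_small ?ltn_ord //.
by case: ifP => _; rewrite ?inE.
Qed.

Lemma in_nbrs_vertex x : in_nbrs (vertex_of x) = set0.
Proof.
apply/setP=> u; rewrite !inE; apply/negP=> /(pair_arc_bounds (ltn_ord _))/andP[_].
by rewrite leqNgt /= ltn_ord.
Qed.

(** Case analysis through [vertexP] replaces index arithmetic in what follows. *)
Variant vertex_spec : 'I_(dorder pair_digraph) -> Type :=
  | IsVertex x : vertex_spec (vertex_of x)
  | IsPair x y : vertex_spec (pair_vertex x y).

Lemma vertexP v : vertex_spec v.
Proof.
have n_gt0 : 0 < n := gorder_gt0 G.
case: (ltnP v n) => [lt_vn|le_nv].
  suff -> : v = vertex_of (Ordinal lt_vn) by constructor.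
  exact: val_inj.
have lt_v : v < n + n * n := ltn_ord v.
have ltx : (v - n) %/ n < n by rewrite ltn_divLR // ltn_subLR.
have lty : (v - n) %% n < n by rewrite ltn_mod.
suff -> : v = pair_vertex (Ordinal ltx) (Ordinal lty) by constructor.
by apply: val_inj; rewrite /= -divn_eq subnKC.
Qed.

Lemma pair_digraph_dag_indeg2 : dag_indeg2 pair_digraph.
Proof.
split=> [[|x p] // _|v].
  have src u v : @arc pair_digraph u v -> u < n <= v.
    exact: pair_arc_bounds (ltn_ord v).
  (* On a longer cycle, the first arc leaves [x], so [x < n], while the closing arc enters [x], so
     [n <= x]. *)
  apply/negP; rewrite /cycle rcons_path => /andP[path_p].
  case: p path_p => [|y p] /=; first by rewrite pair_rel_irr.
  by case/andP=> /src/andP[lt_xn _] _ /src/andP[_]; rewrite leqNgt lt_xn.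
case: (vertexP v) => [x|x y]; first by rewrite in_nbrs_vertex cards0.
by rewrite in_nbrs_pair; case: ifP => _; rewrite ?cards0 // cards2; case: eqP.
Qed.

Lemma total_weight_extend S : total_weight (extend S) = (#|S|%:R)%R.
Proof.
rewrite /total_weight big_imset /=; last by move=> x y _ _; apply: vertex_of_inj.
rewrite -sumr_const; apply: eq_bigr => x _.
by rewrite /pair_weight /= ltn_ord.
Qed.

(** No nonempty in-neighbourhood of a gadget lies in [extend S], as it would come from an edge
    inside [S]. The weight is at most [n], below [2 ^ n]. *)
Lemma extend_feasible S : independent S -> ssgw_feasible (extend S).
Proof.
move=> indS; split=> [v|]; last first.
  rewrite total_weight_extend ler_nat (leq_trans (max_card _)) // card_ord.
  exact/ltnW/ltn_expl.
case: (vertexP v) => [x|x y]; first by rewrite in_nbrs_vertex eqxx.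
rewrite in_nbrs_pair; case: ifP => [adj_xy|]; last by rewrite eqxx.
rewrite subUset !sub1set !mem_imset; try exact: vertex_of_inj.
by case/andP=> Sx Sy; have := indS x y Sx Sy; rewrite adj_xy.
Qed.

(** One gadget alone outweighs the bound, and the other weights are nonnegative. *)
Lemma pair_vertex_notin S x y : ssgw_feasible S -> pair_vertex x y \notin S.
Proof.
case=> _; apply: contraTN => Sxy; rewrite -ltNge /total_weight (bigD1 _ Sxy) /=.
apply: ltr_wpDr; first by apply: sumr_ge0 => v _; apply: pair_weight_ge0.
by rewrite /pair_weight /= ltnNge leq_addr /= ltr_nat ltn_exp2l.
Qed.

(** Without gadgets, [S] consists of vertices of the graph only. *)
Lemma restrictK S : ssgw_feasible S -> extend (restrict S) = S.
Proof.
move=> feasS; apply/setP=> v; case: (vertexP v) => [x|x y].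
  by rewrite mem_imset ?inE //; apply: vertex_of_inj.
rewrite (negPf (pair_vertex_notin x y feasS)); apply/negP.
case/imsetP=> z _ /(congr1 val) /= def_z.
by have := ltn_ord z; rewrite -def_z ltnNge leq_addr.
Qed.

(** Two adjacent elements would force their gadget into [S]. *)
Lemma restrict_independent S : ssgw_feasible S -> independent (restrict S).
Proof.
move=> feasS x y; rewrite !inE => Sx Sy; apply/negP=> adj_xy.
have /negP[] := pair_vertex_notin x y feasS.
case: feasS => weakS _; apply: weakS; rewrite in_nbrs_pair adj_xy.
  by rewrite subUset !sub1set Sx.
by apply/set0Pn; exists (vertex_of x); rewrite !inE eqxx.
Qed.

(** Adding an undominated [x] to the restriction keeps it independent, so its extension is a larger
    feasible set. *)
Lemma restrict_dominating S :
    ssgw_feasible S ->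
    (forall S' : {set 'I_(dorder pair_digraph)}, S \proper S' -> ~ ssgw_feasible S') ->
  dominating (restrict S).
Proof.
move=> feasS maxS x Sx; set A := restrict S in Sx *.
have [/existsP[y /andP[Ay adj_xy]]|noadj] := boolP [exists y, (y \in A) && adj x y].
  by exists y.
have {}noadj y : y \in A -> ~~ adj x y.
  by move=> Ay; apply: contra noadj => adj_xy; apply/existsP; exists y; rewrite Ay.
case: (maxS (extend (x |: A))).
  rewrite -(restrictK feasS) -/A.
  rewrite /proper imsetS ?subsetUr //=; apply/negP=> /subsetP/(_ (vertex_of x)).
  rewrite !mem_imset; try exact: vertex_of_inj.
  by rewrite setU11 (negPf Sx) => /(_ isT).
have indA := restrict_independent feasS.
apply: extend_feasible => y z /setU1P[->|Ay] /setU1P[->|Az].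
- by rewrite adj_irr.
- exact: noadj.
- by rewrite adj_sym noadj.
- exact: indA.
Qed.

(** A feasible [S'] could gain only vertices of the graph, and a gained vertex has a neighbour in
    [S], against the independence of [restrict S']. *)
Lemma extend_maximal S (S' : {set 'I_(dorder pair_digraph)}) :
  dominating S -> extend S \proper S' -> ~ ssgw_feasible S'.
Proof.
move=> domS /properP[sSS' [v S'v Sv]] feasS'.
have indS' := restrict_independent feasS'.
case: (vertexP v) S'v Sv => [x|x y]; last by rewrite (negPf (pair_vertex_notin x y feasS')).
rewrite mem_imset; last exact: vertex_of_inj.
move=> S'x Sx; have [y Sy adj_xy] := domS x Sx.
have := indS' x y; rewrite !inE adj_xy => /(_ S'x).
by rewrite (subsetP sSS') ?imset_f // => /(_ isT).
Qed.

(** * Existence of optimal solutions *)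

Lemma independentP (S : {set 'I_n}) :
  reflect (independent S) [forall x in S, forall y in S, ~~ adj x y].
Proof.
apply: (iffP forall_inP) => [indS x y Sx Sy|indS x Sx].
  by have /forall_inP/(_ y Sy) := indS x Sx.
by apply/forall_inP=> y; apply: indS.
Qed.

Lemma dominatingP (S : {set 'I_n}) :
  reflect (dominating S) [forall (x | x \notin S), exists y in S, adj x y].
Proof.
apply: (iffP forall_inP) => domS x Sx; first by have /exists_inP := domS x Sx.
by apply/exists_inP; apply: domS.
Qed.

Lemma exists_max_independent :
  exists2 S : {set 'I_n}, independent S &
    forall S' : {set 'I_n}, independent S' -> #|S'| <= #|S|.
Proof.
pose ind (S : {set 'I_n}) := [forall x in S, forall y in S, ~~ adj x y].
have ind0 : ind set0 by apply/independentP=> x y; rewrite inE.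
case: (arg_maxnP (fun S : {set 'I_n} => #|S|) ind0) => S /independentP indS maxS.
by exists S => // S' /independentP/maxS.
Qed.

(** The claim passes through the digraph: [extend S] is maximal feasible, since a larger feasible
    set would restrict to a larger independent set. *)
Lemma max_independent_dominating (S : {set 'I_n}) :
    independent S -> (forall S' : {set 'I_n}, independent S' -> #|S'| <= #|S|) ->
  dominating S.
Proof.
move=> indS maxS; rewrite -(extendK S); apply: restrict_dominating.
  exact: extend_feasible.
move=> S' ltSS' feasS'; have := proper_card ltSS'.
rewrite -(restrictK feasS') !card_imset; try exact: vertex_of_inj.
by rewrite ltnNge maxS //; apply: restrict_independent.
Qed.

Lemma exists_min_independent_dominating :
  exists2 S : {set 'I_n}, independent S /\ dominating S &
    forall S' : {set 'I_n}, independent S' /\ dominating S' -> #|S| <= #|S'|.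
Proof.
pose ids (S : {set 'I_n}) := [forall x in S, forall y in S, ~~ adj x y] &&
  [forall (x | x \notin S), exists y in S, adj x y].
have idsP S : reflect (independent S /\ dominating S) (ids S).
  by apply: (iffP andP) => -[/independentP indS /dominatingP domS].
(* A maximum independent set shows that independent dominating sets exist, so a smallest one can be
   chosen. *)
have [S0 indS0 maxS0] := exists_max_independent.
have /idsP ids0 := conj indS0 (max_independent_dominating indS0 maxS0).
case: (arg_minnP (fun S : {set 'I_n} => #|S|) ids0) => S /idsP idsS minS.
by exists S => // S' /idsP/minS.
Qed.

End Digraph.

(** * Correctness of the programs *)

Lemma map_iota_pair_arc w n u :
  [seq pair_arc w n u v | v <- iota 0 (n + n * n)] = row_word w n u.
Proof.
rewrite iotaD map_cat /row_word; congr (_ ++ _).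
  rewrite -[n in RHS](size_iota 0 n) -flatten_const1 flatten_map1.
  apply/eq_in_map => v; rewrite mem_iota /= => lt_vn.
  by rewrite /pair_arc leqNgt lt_vn.
rewrite iota_mul map_flatten -map_comp; congr flatten.
apply/eq_in_map => x _ /=; rewrite flatten_map1 -map_comp.
apply/eq_in_map => y /=; rewrite mem_iota /= => lt_yn.
(* Division of [x * n + y] by [n] recovers [x] and [y]. *)
rewrite /pair_arc leq_addr addKn divnMDl ?(leq_ltn_trans _ lt_yn) //.
by rewrite divn_small // addn0 modnMDl modn_small.
Qed.

Lemma flatten_flatten (T : Type) (sss : seq (seq (seq T))) :
  flatten (flatten sss) = flatten [seq flatten ss | ss <- sss].
Proof. by elim: sss => //= ss sss IHsss; rewrite flatten_cat IHsss. Qed.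

Lemma map_enum_ord (T : Type) (f : nat -> T) n :
  [seq f (val i) | i <- enum 'I_n] = [seq f i | i <- iota 0 n].
Proof. by rewrite -val_enum_ord -map_comp. Qed.

Lemma enc_pair_digraph G :
  enc_ssg (pair_digraph G) =
  matrix_word (enc_rel (@adj G)) (gorder G) ++ weight_word (gorder G).
Proof.
set n := gorder G; set w := enc_rel _.
rewrite /enc_ssg /matrix_word -!catA; congr (_ ++ _ :: _); congr (_ ++ _).
  rewrite -(map_enum_ord (row_word w n)); congr flatten.
  apply: eq_map => u; rewrite -map_iota_pair_arc -map_enum_ord.
  by [].
rewrite /weight_word [RHS]catA; congr (_ ++ _); last exact: enc_rat_pow2.
(* Weights as a function of the numerical index, so that [iota] can replace the enumeration of
   ordinals. *)
pose wt v := enc_rat (if (v < n)%N then 1 else (2 ^ n.+1)%:R)%R.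
rewrite -[LHS]/(flatten [seq wt (val v) | v <- enum 'I_(n + n * n)]) map_enum_ord.
rewrite iotaD map_cat flatten_cat; congr (_ ++ _).
  by congr flatten; apply/eq_in_map => v; rewrite /wt mem_iota /= => ->.
rewrite iota_mul map_flatten flatten_flatten -!map_comp; congr flatten.
apply: eq_map => x /=; rewrite -map_comp; congr flatten.
by apply: eq_map => y /=; rewrite /wt ltnNge leq_addr enc_rat_pow2.
Qed.

Lemma enc_set_restrict G (S : {set 'I_(dorder (pair_digraph G))}) :
  enc_set (restrict S) = [seq nth false (enc_set S) i | i <- iota 0 (gorder G)].
Proof.
rewrite -map_enum_ord; apply: eq_map => x; rewrite inE.
set v := vertex_of x; rewrite -[val x]/(val v).
by rewrite (nth_map v) ?size_enum_ord ?ltn_ord // nth_ord_enum.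
Qed.

Lemma polytime_pair_digraph :
  polytime (fun=> True) (fun G => enc_rel (@adj G)) (fun G => enc_ssg (pair_digraph G)).
Proof.
have [c [k le_time]] := poly_bounded_ssg_time.
exists ssg_prog, c, k => G _.
have [|t [m [ex_t le_t _]]] :=
  @runs_ssg _ (gorder G) (@nth_enc_rel_ones _ (@adj G)) (fun=> 0) [::]; first by [].
exists t; exists (State m (enc_ssg (pair_digraph G))); split=> //.
  by rewrite enc_pair_digraph.
apply: leq_trans le_t (leq_trans (le_time _) _).
(* The unary prefix makes the input at least [n] long. *)
by apply: leq_poly_bound_arg; rewrite size_enc_rel leq_addr.
Qed.

Lemma polytime_restrict
    (D : {G : connected_graph & {set 'I_(dorder (pair_digraph G))}} -> Prop) :
  polytime D
    (fun x => enc_pair (enc_rel (@adj (projT1 x))) (enc_set (projT2 x)))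
    (fun x => enc_set (restrict (projT2 x))).
Proof.
(* The time is [2 * L + 5 * n + 4] with [n <= L], and the input has more than [2 * L] letters. *)
exists restrict_prog, 10, 1 => -[G S] _ /=.
have [|t [m [ex_t le_t _]]] :=
  @runs_restrict _ (@adj G) (enc_set S) (fun=> 0) [::]; first by [].
exists t; exists (State m (enc_set (restrict S))); split=> //.
  by rewrite enc_set_restrict.
apply: leq_trans le_t _; rewrite expn1 !size_enc_rel.
by rewrite [size (enc_pair _ _)]size_cat size_nseq /= size_cat size_enc_rel; lia.
Qed.

(** Value-preserving maps in both directions: [h] carries an optimum over, and [g] shows that
    nothing on the other side beats it. *)
Lemma is_opt_transfer (P Q : opt_problem) (I : inst P) (J : inst Q)
    (g : sol Q J -> sol P I) (h : sol P I -> sol Q J) v :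
    maximize P = maximize Q ->
    (forall S', feasible Q J S' ->
       feasible P I (g S') /\ value P I (g S') = value Q J S') ->
    (forall S, feasible P I S ->
       feasible Q J (h S) /\ value Q J (h S) = value P I S) ->
  is_opt I v -> is_opt J v.
Proof.
move=> eq_max gP hP [[S feasS <-] optS]; split.
  by have [feas_hS val_hS] := hP S feasS; exists (h S).
by move=> S' /gP[/optS + <-]; rewrite -eq_max.
Qed.

Lemma restrict_ssgw G (S : {set 'I_(dorder (pair_digraph G))}) :
    ssgw_feasible S ->
  independent (restrict S) /\ (#|restrict S|%:R)%R = total_weight S.
Proof.
move=> feasS; split; first exact: restrict_independent.
by rewrite -{2}(restrictK feasS) total_weight_extend.
Qed.

Theorem theorem3 :
  approx_reduction IS SSGW dag_indeg2 /\
  approx_reduction ISDS MaximalSSGW dag_indeg2.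
Proof.
(* The same digraph and the same restriction serve both reductions. *)
split; exists pair_digraph, restrict.
- split; [exact: polytime_pair_digraph | exact: polytime_restrict
         | exact: pair_digraph_dag_indeg2 | | exact: restrict_ssgw].
  move=> G; have [S indS maxS] := exists_max_independent G.
  have optS : is_opt (P := IS) G (#|S|%:R)%R.
    by split=> [|S' /maxS leS']; [exists S | rewrite /= ler_nat].
  exists (#|S|%:R)%R => //.
  apply: (is_opt_transfer (P := IS) (Q := SSGW) (g := @restrict G) (h := @extend G)) optS => //.
    exact: restrict_ssgw.
  by move=> S' indS'; split; [apply: extend_feasible | apply: total_weight_extend].
- have gP G (S : {set 'I_(dorder (pair_digraph G))}) :
      feasible MaximalSSGW (pair_digraph G) S ->
      feasible ISDS G (restrict S) /\
      value ISDS G (restrict S) = value MaximalSSGW (pair_digraph G) S.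
    move=> [feasS maxS]; have [indS valS] := restrict_ssgw feasS.
    by split=> //; split=> //; apply: restrict_dominating.
  split; [exact: polytime_pair_digraph | exact: polytime_restrict
         | exact: pair_digraph_dag_indeg2 | | exact: gP].
  move=> G; have [S idsS minS] := exists_min_independent_dominating G.
  have optS : is_opt (P := ISDS) G (#|S|%:R)%R.
    by split=> [|S' /minS leS']; [exists S | rewrite /= ler_nat].
  exists (#|S|%:R)%R => //.
  apply: (is_opt_transfer (P := ISDS) (Q := MaximalSSGW) (g := @restrict G)
            (h := @extend G)) optS => //; first exact: gP.
  move=> S' [indS' domS']; split; last exact: total_weight_extend.
  by split; [apply: extend_feasible | move=> S''; apply: extend_maximal].
Qed.
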